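(* For every finite graph $G$, the isomorphism class of the $\mathbb Z^3$-graded vector space $\mathcal N_0(G)$ is a graph invariant (isomorphic graphs give isomorphic graded vector spaces), and $$\operatorname{Hilb}(\mathcal N_0(G))=f(G;t,x,y).$$
   Context: Graphs are finite and may have loops and multiple edges. For $S\subseteq E(G)$, $\omega_G(S)$ denotes the number of connected components of the spanning subgraph $(V(G),S)$. The Negami polynomial $f(G;t,x,y)$, a polynomial in the indeterminates $t,x,y$, is the graph invariant determined by $f(\overline K_n;t,x,y)=t^n$, where $\overline K_n$ is the graph with $n$ vertices and no edges, and, for every edge $e$ of $G$, $f(G;t,x,y)=x\,f(G/e;t,x,y)+y\,f(G-e;t,x,y)$, where $G-e$ is deletion, $G/e$ is contraction (identify the endpoints of $e$ and remove $e$, keeping all other edges), and $G/e=G-e$ if $e$ is a loop. Let $\mathbf k$ be a field. For a finite-dimensional $\mathbb Z^3$-graded $\mathbf k$-vector space $M$, put $\operatorname{Hilb}(M)=\sum_{i,j,k}\dim_{\mathbf k}M_{i,j,k}\,t^ix^jy^k$. The grading shift $M\{a,b,c\}$ is normalized so that $\operatorname{Hilb}(M\{a,b,c\})=t^ax^by^c\operatorname{Hilb}(M)$, i.e. $M\{a,b,c\}_{i,j,k}=M_{i-a,j-b,k-c}$; in particular $\mathbf k\{a,b,c\}$ is one-dimensional, concentrated in degree $(a,b,c)$. The Negami state object is $$\mathcal N_0(G)=\bigoplus_{S\subseteq E(G)}\mathbf k\{\omega_G(S),|S|,|E(G)|-|S|\}.$$ *)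

(* Defs.v *)
From HB Require Import structures.
From mathcomp Require Import all_boot all_order all_algebra.
From mathcomp Require Import classical_sets cardinality fsbigop.
From mathcomp Require Import mpoly.

Set Implicit Arguments.
Unset Strict Implicit.
Unset Printing Implicit Defensive.

Import GRing.Theory.

Local Open Scope ring_scope.

(** * Finite graphs with loops and multiple edges *)

(* An edge is sent to its set of endpoints: a singleton for a loop, a pair
   otherwise. *)
Record graph := Graph {
  vert : finType;
  edge : finType;
  ends : edge -> {set vert};
  endsP : forall e, (0 < #|ends e| <= 2)%N
}.

Definition graph_iso (G H : graph) : Prop :=
  exists (phiV : vert G -> vert H) (phiE : edge G -> edge H),
    [/\ bijective phiV, bijective phiE
      & forall e, ends (phiE e) = phiV @: ends e].

Definition is_loop (G : graph) (e : edge G) : bool := #|ends e| == 1%N.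

Definition adj (G : graph) : rel (vert G) :=
  fun u v => [exists e : edge G, ends e == [set u; v]%SET].

Definition ncomponents (G : graph) : nat := n_comp (@adj G) (vert G).

Definition no_ends (n : nat) (e : void) : {set 'I_n} := match e with end.

Fact no_endsP (n : nat) (e : void) : (0 < #|no_ends n e| <= 2)%N.
Proof. by case: e. Qed.

Definition edgeless (n : nat) : graph := Graph (@no_endsP n).

Section Operations.
Variable G : graph.

Definition sub_ends (S : {set edge G}) (e : {e : edge G | e \in S}) :
  {set vert G} := ends (val e).

Fact sub_endsP (S : {set edge G}) (e : {e : edge G | e \in S}) :
  (0 < #|sub_ends e| <= 2)%N.
Proof. exact: endsP. Qed.

Definition spanning (S : {set edge G}) : graph := Graph (@sub_endsP S).

Definition omega (S : {set edge G}) : nat := ncomponents (spanning S).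

Definition delete (e : edge G) : graph := spanning [set~ e]%SET.

(* The vertices of the graph obtained by identifying the endpoints of [e] are
   the classes of the equivalence relation whose only possibly nontrivial class
   is [ends e]. *)
Definition merge_class (e : edge G) (v : vert G) : {set vert G} :=
  if v \in ends e then ends e else [set v]%SET.

Definition merge_vert (e : edge G) : finType :=
  {B : {set vert G} | B \in [set merge_class e v | v : vert G]%SET}.

Definition merge (e : edge G) (v : vert G) : merge_vert e :=
  exist _ (merge_class e v) (imset_f (merge_class e) (isT : v \in vert G)).

Definition merge_ends (e : edge G) (e' : {e' : edge G | e' \in [set~ e]%SET}) :
  {set merge_vert e} := merge e @: ends (val e').

Fact merge_endsP (e : edge G) (e' : {e' : edge G | e' \in [set~ e]%SET}) :
  (0 < #|merge_ends e'| <= 2)%N.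
Proof.
have /andP[e'_gt0 e'_le2] := endsP (val e').
rewrite (leq_trans (leq_imset_card _ _) e'_le2) andbT.
have /card_gt0P[v ve'] := e'_gt0.
by apply/card_gt0P; exists (merge e v); apply: imset_f.
Qed.

Definition contract (e : edge G) : graph :=
  if is_loop e then delete e else Graph (@merge_endsP e).

End Operations.

(** * The Negami polynomial *)

Definition var_t : {mpoly int[3]} := 'X_0.
Definition var_x : {mpoly int[3]} := 'X_1.
Definition var_y : {mpoly int[3]} := 'X_2.

Definition is_negami (f : graph -> {mpoly int[3]}) : Prop :=
  [/\ forall G H, graph_iso G H -> f G = f H,
      forall n, f (edgeless n) = var_t ^+ n
    & forall (G : graph) (e : edge G),
        f G = var_x * f (contract e) + var_y * f (delete e)].

(** * Finite-dimensional graded vector spaces *)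

Definition deg : Type := (int * int * int)%type.
HB.instance Definition _ := GRing.Zmodule.on deg.

Section Graded.
Variable k : fieldType.

Record grvect := Grvect {
  piece :> deg -> vectType k;
  _ : finite_set [set d : deg | \dim {: piece d} <> 0%N]%classic
}.

Definition gr_iso (M N : grvect) : Prop :=
  exists phi : forall d, {linear M d -> N d}, forall d, bijective (phi d).

Definition gr0_piece (d : deg) : vectType k := 'rV[k]_0.

Fact gr0_fin : finite_set [set d | \dim {: gr0_piece d} <> 0%N]%classic.
Proof.
by apply: (sub_finite_set _ (finite_set0 deg)) => d /=; rewrite dimvf dim_matrix.
Qed.

Definition gr0 : grvect := Grvect gr0_fin.

(* The ground field concentrated in degree 0: the piece of degree [d] is
   [k ^ 1] if [d == 0] and [k ^ 0] otherwise. *)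
Definition gr1_piece (d : deg) : vectType k := 'rV[k]_(d == 0).

Fact gr1_fin : finite_set [set d | \dim {: gr1_piece d} <> 0%N]%classic.
Proof.
apply: (sub_finite_set _ (finite_set1 (0 : deg))) => d /=.
by rewrite dimvf dim_matrix; case: eqP.
Qed.

Definition gr1 : grvect := Grvect gr1_fin.

Definition shift_piece (M : grvect) (a d : deg) : vectType k := M (d - a).

Fact shift_fin (M : grvect) (a : deg) :
  finite_set [set d | \dim {: shift_piece M a d} <> 0%N]%classic.
Proof.
case: M => M finM; apply: (sub_finite_set _ (finite_image (+%R^~ a) finM)).
by move=> d Md; exists (d - a) => //; rewrite subrK.
Qed.

Definition shift (M : grvect) (a : deg) : grvect := Grvect (shift_fin M a).

Definition dsum_piece (M N : grvect) (d : deg) : vectType k :=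
  (M d * N d)%type.

Fact dsum_fin (M N : grvect) :
  finite_set [set d | \dim {: dsum_piece M N d} <> 0%N]%classic.
Proof.
case: M N => [M finM] [N finN].
have finMN : finite_set ([set d | \dim {: M d} <> 0%N] `|`
                         [set d | \dim {: N d} <> 0%N])%classic.
  by rewrite finite_setU.
apply: (sub_finite_set _ finMN) => d /=; rewrite !dimvf => MNd.
have [Md0|/eqP] := eqVneq (dim (M d)) 0%N; last by left.
by right=> Nd0; apply: MNd; rewrite [dim _]/(dim (M d) + dim (N d))%N Md0 Nd0.
Qed.

Definition dsum (M N : grvect) : grvect := Grvect (dsum_fin M N).

(* Hilbert series are Laurent polynomials; they are taken in the field of
   fractions of Z[t, x, y], which contains Z[t^+-1, x^+-1, y^+-1]. *)
Definition laurent_monomial (d : deg) : {fraction {mpoly int[3]}} :=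
  tofrac var_t ^ d.1.1 * tofrac var_x ^ d.1.2 * tofrac var_y ^ d.2.

Definition Hilb (M : grvect) : {fraction {mpoly int[3]}} :=
  \sum_(d \in [set: deg]%classic) laurent_monomial d *+ \dim {: M d}.

Definition negami_state (G : graph) : grvect :=
  \big[dsum/gr0]_(S : {set edge G})
    shift gr1 ((omega S)%:Z, #|S|%:Z, #|edge G|%:Z - #|S|%:Z).

End Graded.

(* Main.v *)
Require Import Defs.
From HB Require Import structures.
From mathcomp Require Import all_boot all_order all_algebra.
From mathcomp Require Import classical_sets cardinality fsbigop.
From mathcomp Require Import mpoly.
From Stdlib Require Import FunctionalExtensionality.

(** Both sides are governed by the subset expansion
      f(G) = \sum_(S \subset E(G)) t^(omega S) x^|S| y^(|E(G)| - |S|).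

    The state object has one basis vector for each S, in the degree whose
    Laurent monomial is the summand of S. So the dimension of its piece of
    degree d counts the S of degree d ([dim_negami_state]), and summing over d
    the monomials with these multiplicities gives back the expansion
    ([Hilb_negami_state]). A finite-dimensional graded space is determined up to
    isomorphism by its dimensions ([gr_iso_of_dim]), and these depend only on
    the isomorphism type of G, because a graph isomorphism permutes the subsets
    of edges while preserving omega, |S| and |E(G)| ([sum_subsets_iso]).

    The expansion satisfies the deletion-contraction rule: the subsets T of the
    edges other than e index both the subsets avoiding e and, by adding e, those
    containing it ([sum_subsets_split]). In the first case the components of T
    are those of T in G - e; in the second, adding e has the same effect on
    components as identifying its endpoints ([omega_contract]). The rule lowers
    the number of edges, and a graph without edges is isomorphic to a standard
    edgeless one, so induction leaves no other solution ([is_negami_unique]).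

    All comparisons of component counts (isomorphisms, deletion, contraction,
    loops) are instances of one fact about a surjective map of vertices whose
    fibres are connected ([ncomponents_quotient]). *)

Set Implicit Arguments.
Unset Strict Implicit.
Unset Printing Implicit Defensive.

Import GRing.Theory passmx.

Local Open Scope ring_scope.

(** * Components of quotient graphs *)

Lemma adjP (G : graph) (u v : vert G) :
  reflect (exists e : edge G, ends e = [set u; v]%SET) (adj u v).
Proof. exact: 'exists_eqP. Qed.

Lemma connect_adj_sym (G : graph) : connect_sym (@adj G).
Proof.
apply: sym_connect_sym => u v.
by apply: eq_existsb => e; rewrite finset.setUC.
Qed.

Lemma ends_pair (G : graph) (e : edge G) : exists u v, ends e = [set u; v]%SET.
Proof.
case/andP: (endsP e) => e_gt0.
rewrite leq_eqVlt => /orP[/cards2P[u [v [_ ->]]]|e_lt2].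
  by exists u, v.
have /cards1P[u ->] : #|ends e| == 1%N by rewrite eqn_leq e_gt0 andbT.
by exists u, u; rewrite finset.setUid.
Qed.

Lemma connect_ends (G : graph) (e : edge G) u v :
  u \in ends e -> v \in ends e -> connect (@adj G) u v.
Proof.
have [a [b e_ab]] := ends_pair e.
have ab : connect (@adj G) a b.
  by apply/connect1/adjP; exists e.
have ba : connect (@adj G) b a by rewrite connect_adj_sym.
by rewrite e_ab !inE => /orP[]/eqP-> /orP[]/eqP->.
Qed.

(** Connected fibres make every walk of [H] liftable to [G]: its edges lift, and
    the gaps between consecutive lifts lie inside fibres. Conversely [h] projects
    walks of [G], an edge either surviving or being collapsed to a point. So
    [h] preserves and reflects connectedness, and induces a bijection on
    components. *)
Lemma ncomponents_quotient (G H : graph) (h : vert G -> vert H) :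
    (forall x, exists u, h u = x) ->
    (forall u v, h u = h v -> connect (@adj G) u v) ->
    (forall e : edge H, exists e' : edge G, ends e = h @: ends e') ->
    (forall e : edge G, (exists e' : edge H, ends e' = h @: ends e) \/
                        {in ends e &, forall u v, h u = h v}) ->
  ncomponents G = ncomponents H.
Proof.
move=> h_surj h_fib h_lift h_edge.
have h_unit x : {u | connect (@adj H) x (h u)}.
  by have /sig_eqW[u <-] := h_surj x; exists u.
suff h_functor u v : connect (@adj G) u v = connect (@adj H) (h u) (h v).
  have adjn : rel_adjunction h (@adj H) (@adj G) (vert H) by split.
  rewrite /ncomponents (adjunction_n_comp h _ _ _ adjn) //;
    exact: connect_adj_sym.
apply/idP/idP.
  case/connectP=> p + ->.
  elim: p u => //= w p IHp u /andP[/adjP[e e_uw] /IHp].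
  have [ue we] : u \in ends e /\ w \in ends e by rewrite e_uw !inE !eqxx orbT.
  apply: connect_trans; have [[e' e'h]|h_const] := h_edge e.
    by apply: (@connect_ends _ e'); rewrite e'h imset_f.
  by rewrite (h_const u w).
move=> /connectP[p]; elim: p u => [|y p IHp] u /=; first by move=> _ /esym/h_fib.
move=> /andP[/adjP[e e_uy] p_path v_last].
have [e' e'h] := h_lift e.
have /imsetP[a ae' ha] : h u \in h @: ends e' by rewrite -e'h e_uy !inE eqxx.
have /imsetP[b be' hb] : y \in h @: ends e' by rewrite -e'h e_uy !inE eqxx orbT.
subst y; apply: connect_trans (h_fib _ _ ha) _.
exact: connect_trans (connect_ends ae' be') (IHp b p_path v_last).
Qed.

(** Since [h] is a map of vertices alone, the edges of [S] and [T] need only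
    correspond through their endpoints; no map of edges has to be supplied. *)
Lemma omega_eq (G H : graph) (h : vert G -> vert H)
    (S : {set edge G}) (T : {set edge H}) :
    (forall x, exists u, h u = x) ->
    (forall u v, h u = h v -> connect (@adj (spanning S)) u v) ->
    {in T, forall e, exists2 e', e' \in S & ends e = h @: ends e'} ->
    {in S, forall e, (exists2 e', e' \in T & ends e' = h @: ends e) \/
                     {in ends e &, forall u v, h u = h v}} ->
  omega S = omega T.
Proof.
move=> h_surj h_fib h_lift h_edge.
apply: (@ncomponents_quotient (spanning S) (spanning T) h) => //.
  by case=> e Te; have [e' Se' ?] := h_lift e Te; exists (exist _ e' Se').
case=> e Se; have [[e' Te' ?]|] := h_edge e Se; last by right.
by left; exists (exist _ e' Te').
Qed.

(** * Isomorphism invariance of subset sums *)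

Lemma omega_iso (G H : graph) (phiV : vert G -> vert H)
    (phiE : edge G -> edge H) (S : {set edge G}) :
    bijective phiV -> (forall e, ends (phiE e) = phiV @: ends e) ->
  omega (phiE @: S) = omega S.
Proof.
move=> bij_V endsE; have inj_V := bij_inj bij_V; have [psi _ phiK] := bij_V.
apply/esym/(@omega_eq _ _ phiV).
- by move=> x; exists (psi x); rewrite phiK.
- by move=> u v /inj_V->.
- by move=> _ /imsetP[e Se ->]; exists e.
by move=> e Se; left; exists (phiE e); first exact: imset_f.
Qed.

(** Stated for an arbitrary summand so as to serve both for the polynomial, with
    monomials as summands, and for the dimensions of the state object, with
    indicators of a degree. *)
Lemma sum_subsets_iso (R : nmodType) (F : nat -> nat -> nat -> R) (G H : graph) :
    graph_iso G H ->
  \sum_(S : {set edge G}) F (omega S) #|S| #|edge G| =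
  \sum_(T : {set edge H}) F (omega T) #|T| #|edge H|.
Proof.
move=> [phiV [phiE [bij_V bij_E endsE]]]; have inj_E := bij_inj bij_E.
have [psi phiK psiK] := bij_E.
rewrite [RHS](reindex (fun S : {set edge G} => phiE @: S)); last first.
  exists (fun T : {set edge H} => psi @: T) => S _; rewrite -imset_comp.
    by rewrite -[RHS]imset_id; apply: eq_imset.
  by rewrite -[RHS]imset_id; apply: eq_imset.
apply: eq_bigr => S _.
by rewrite (omega_iso S bij_V) // card_imset // (bij_eq_card bij_E).
Qed.

(** * The subset expansion of the Negami polynomial *)

Definition negami_poly (G : graph) : {mpoly int[3]} :=
  \sum_(S : {set edge G})
    var_t ^+ omega S * var_x ^+ #|S| * var_y ^+ (#|edge G| - #|S|).

Lemma negami_poly_iso (G H : graph) :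
  graph_iso G H -> negami_poly G = negami_poly H.
Proof.
exact: (sum_subsets_iso
          (fun w m n => var_t ^+ w * var_x ^+ m * var_y ^+ (n - m))).
Qed.

Lemma negami_poly_edgeless n : negami_poly (edgeless n) = var_t ^+ n.
Proof.
have S0 (S : {set edge (edgeless n)}) : S = finset.set0 by apply/setP=> -[].
rewrite /negami_poly (big_pred1 finset.set0) => [|S]; last by rewrite (S0 S) /= eqxx.
rewrite cards0 subn0 card_void !expr0 !mulr1; congr (_ ^+ _).
rewrite /omega /ncomponents /n_comp_mem -[RHS]card_ord; apply: eq_card => u.
rewrite !inE andbT; apply/eqP.
pose G0 := spanning (finset.set0 : {set edge (edgeless n)}).
have /connectP[p] := connect_root (@adj G0) u.
by case: p => //= v p /andP[/adjP[[[]]]].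
Qed.

Section DeletionContraction.
Variables (G : graph) (e : edge G).

Let E : finType := {e' : edge G | e' \in [set~ e]%SET}.

Let val_neq (e' : E) : val e' != e.
Proof. by have := valP e'; rewrite !inE. Qed.

Let e_notin (T : {set E}) : e \notin val @: T.
Proof.
by apply/imsetP=> -[e' _ eq_e]; have := val_neq e'; rewrite -eq_e eqxx.
Qed.

Lemma card_other_edges : #|edge G| = #|E|.+1.
Proof. by rewrite card_sig cardsC1 prednK //; apply/card_gt0P; exists e. Qed.

Lemma sum_subsets_split (R : nmodType) (F : {set edge G} -> R) :
  \sum_S F S = \sum_(T : {set E}) F (e |: val @: T)%SET
               + \sum_(T : {set E}) F (val @: T)%SET.
Proof.
have valK (T : {set E}) : val @^-1: (val @: T) = T :> {set E}.
  by apply/setP=> e'; rewrite inE mem_imset //; apply: val_inj.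
have preK (S : {set edge G}) : e \notin S -> val @: (val @^-1: S : {set E}) = S.
  move=> eS; apply/setP=> f; apply/imsetP/idP => [[f' + ->]|fS].
    by rewrite inE.
  have fe : f \in [set~ e]%SET by rewrite !inE; apply: contraNneq eS => <-.
  by exists (exist _ f fe); rewrite ?inE.
rewrite (bigID (fun S : {set edge G} => e \in S)) /=; congr (_ + _).
  rewrite (reindex_onto (fun T : {set E} => e |: val @: T)%SET
                        (fun S : {set edge G} => val @^-1: S : {set E}))
          /=; last first.
    move=> S eS.
    have -> : val @^-1: S = val @^-1: (S :\ e)%SET :> {set E}.
      by apply/setP=> e'; rewrite !inE val_neq.
    by rewrite preK ?inE ?eqxx // finset.setD1K.
  apply: eq_bigl => T; rewrite finset.setU11 /=; apply/eqP; apply/setP => e'.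
  by rewrite !inE (negPf (val_neq e')) mem_imset //; apply: val_inj.
rewrite (reindex_onto (fun T : {set E} => val @: T)
                        (fun S : {set edge G} => val @^-1: S : {set E}))
          /=; last first.
  by move=> S; apply: preK.
by apply: eq_bigl => T; rewrite e_notin valK eqxx.
Qed.

Lemma omega_delete (T : {set edge (delete e)}) :
  omega (val @: T : {set edge G}) = omega T.
Proof.
apply: (@omega_eq G (delete e) id (val @: T) T); first by move=> u; exists u.
- by move=> v w /= ->; apply: connect0.
- by move=> e' Te'; exists (val e'); rewrite ?imset_id ?imset_f.
by move=> _ /imsetP[e' Te' ->]; left; exists e'; rewrite ?imset_id.
Qed.

(** When [e] is a loop, contraction is deletion and [e] joins no two distinct
    vertices. Otherwise the only nontrivial fibre of the quotient map is the set
    of endpoints of [e], which [e] itself connects, and [e] is the only edge that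
    does not survive. *)
Lemma omega_contract (T : {set E}) :
  omega (e |: val @: T : {set edge G})%SET =
  (if is_loop e then omega (T : {set edge (delete e)})
   else omega (T : {set edge (Graph (@merge_endsP G e))})).
Proof.
case: ifP => [/cards1P[u eu]|_].
  apply: (@omega_eq G (delete e) id (e |: val @: T)%SET T).
  - by move=> v; exists v.
  - by move=> v w /= ->; apply: connect0.
  - by move=> e' Te'; exists (val e'); rewrite ?imset_id // inE imset_f ?orbT.
  move=> e'; rewrite !inE => /orP[/eqP->|/imsetP[f Tf ->]].
    by right=> v w; rewrite eu !inE => /eqP-> /eqP->.
  by left; exists f; rewrite ?imset_id.
apply: (@omega_eq G (Graph (@merge_endsP G e)) (Defs.merge e)
                  (e |: val @: T)%SET T).
- case=> B; move: (B) => _ /[dup] /imsetP[v _ ->] Bv.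
  by exists v; apply: val_inj.
- move=> u v /(congr1 val) /=; rewrite /merge_class.
  have eS : e \in (e |: val @: T)%SET by rewrite finset.setU11.
  case: ifP => ue; case: ifP => ve.
  + by move=> _; apply: (@connect_ends (spanning _) (exist _ e eS)).
  + by move/setP/(_ u); rewrite ue inE => /esym/eqP uv; rewrite -uv ue in ve.
  + by move/setP/(_ v); rewrite ve inE => /eqP uv; rewrite uv ue in ve.
  by move/setP/(_ u); rewrite !inE eqxx => /esym/eqP->.
- by move=> e' Te'; exists (val e') => //; rewrite inE imset_f ?orbT.
move=> e'; rewrite !inE => /orP[/eqP->|/imsetP[f Tf ->]]; last by left; exists f.
by right=> v w ve we; apply: val_inj; rewrite /= /merge_class ve we.
Qed.

Lemma negami_poly_rec :
  negami_poly G =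
  var_x * negami_poly (contract e) + var_y * negami_poly (delete e).
Proof.
rewrite {1}/negami_poly sum_subsets_split; congr (_ + _); last first.
  rewrite /negami_poly mulr_sumr; apply: eq_bigr => T _.
  rewrite -omega_delete (card_imset _ val_inj) card_other_edges subSn ?max_card //.
  by rewrite exprS mulrCA.
have cardT (T : {set E}) : #|(e |: val @: T)%SET| = #|T|.+1.
  by rewrite cardsU1 e_notin (card_imset _ val_inj).
rewrite /contract; case: ifP => loop; rewrite /negami_poly mulr_sumr;
  apply: eq_bigr => T _;
  by rewrite omega_contract loop cardT card_other_edges subSS
             exprS (mulrCA _ var_x) -!mulrA.
Qed.

Lemma card_edge_contract : #|edge (contract e)| = #|E|.
Proof. by rewrite /contract; case: ifP. Qed.

End DeletionContraction.

Lemma negami_poly_is_negami : is_negami negami_poly.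
Proof.
split; [exact: negami_poly_iso | exact: negami_poly_edgeless |].
exact: negami_poly_rec.
Qed.

Lemma graph_iso_edgeless (G : graph) :
  #|edge G| = 0%N -> graph_iso G (edgeless #|vert G|).
Proof.
move=> /card0_eq noE; have noedge (e : edge G) : False by have := noE e.
exists enum_rank, (fun e => match noedge e with end); split.
- exact: (Bijective (@enum_rankK _) (@enum_valK _)).
- by exists (fun e : void => match e with end) => [e|[]]; case: (noedge e).
- by move=> e; case: (noedge e).
Qed.

Lemma is_negami_unique (f g : graph -> {mpoly int[3]}) :
  is_negami f -> is_negami g -> f = g.
Proof.
move=> [f_iso f_edgeless f_rec] [g_iso g_edgeless g_rec].
apply: functional_extensionality => G; have [n] := ubnP #|edge G|.
elim: n G => // n IHn G ltGn.
have [/graph_iso_edgeless isoG|] := posnP #|edge G|.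
  by rewrite (f_iso _ _ isoG) (g_iso _ _ isoG) f_edgeless g_edgeless.
case/card_gt0P=> e _; rewrite (f_rec _ e) (g_rec _ e).
by congr (_ * _ + _ * _); apply: IHn;
  rewrite ?card_edge_contract -ltnS -(card_other_edges e).
Qed.

(** * Dimensions of the state object *)

Section StateObject.
Variable k : fieldType.

(** The conclusion is a sigma type rather than an existential so that an
    isomorphism can be picked in every degree at once without choice. *)
Lemma linear_bij_of_dim (U V : vectType k) :
  \dim {: U} = \dim {: V} -> {phi : {linear U -> V} | bijective phi}.
Proof.
move=> dimUV.
pose X := vbasis {: U}; pose Y := vbasis {: V}.
have [psi bij_psi] :
    {psi : {linear 'rV[k]_(\dim {: U}) -> 'rV[k]_(\dim {: V})} | bijective psi}.
  by case: _ / dimUV; exists idfun; exists idfun.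
pose f : {linear U -> _} := psi \o rVof X.
exists (vecof Y \o f : {linear U -> V}); apply: bij_comp; last apply: bij_comp => //.
- exact: (Bijective (vecofK (vbasisP _)) (rVofK (vbasisP _))).
exact: (Bijective (rVofK (vbasisP _)) (vecofK (vbasisP _))).
Qed.

Lemma gr_iso_of_dim (M N : grvect k) :
  (forall d, \dim {: M d} = \dim {: N d}) -> gr_iso M N.
Proof.
move=> dimMN; exists (fun d => sval (linear_bij_of_dim (dimMN d))) => d.
exact: (svalP (linear_bij_of_dim (dimMN d))).
Qed.

Definition state_deg (w m n : nat) : deg := (w%:Z, m%:Z, n%:Z - m%:Z).

Lemma dim_negami_state (G : graph) (d : deg) :
  \dim {: negami_state k G d} =
  (\sum_(S : {set edge G}) (d == state_deg (omega S) #|S| #|edge G|))%N.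
Proof.
rewrite dimvf /negami_state.
rewrite (big_morph (fun M : grvect k => dim (M d)) (id1 := 0%N) (op1 := addn)) //.
apply: eq_bigr => S _; rewrite -subr_eq0.
(* A space of rows of length b is one of 1 x b matrices, of dimension 1 * b. *)
exact: (mul1n (d - state_deg (omega S) #|S| #|edge G| == 0)).
Qed.

Lemma negami_state_iso (G H : graph) :
  graph_iso G H -> gr_iso (negami_state k G) (negami_state k H).
Proof.
move=> isoGH; apply: gr_iso_of_dim => d; rewrite !dim_negami_state.
exact: (sum_subsets_iso (fun w m n => (d == state_deg w m n) : nat) isoGH).
Qed.

Lemma laurent_monomial_state_deg w m n : (m <= n)%N ->
  laurent_monomial (state_deg w m n) =
  tofrac (var_t ^+ w * var_x ^+ m * var_y ^+ (n - m)).
Proof.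
by move=> le_mn; rewrite /laurent_monomial /= subzn // -!exprnP !tofracM !tofracXn.
Qed.

Lemma Hilb_negami_state (G : graph) :
  Hilb (negami_state k G) = tofrac (negami_poly G).
Proof.
pose a (S : {set edge G}) := state_deg (omega S) #|S| #|edge G|.
(* The support of the Hilbert series lies in the finite list of the degrees of
   the subsets, without repetitions. *)
pose r := undup [seq a A | A <- enum {set edge G}].
have ar S : a S \in r by rewrite mem_undup map_f ?mem_enum.
rewrite /Hilb (fsbigE r) ?undup_uniq //; last first.
  move=> d _ dr; rewrite dim_negami_state big1 // => S _.
  by case: eqP dr => // ->; rewrite ar.
transitivity (\sum_(d <- r) \sum_(S : {set edge G})
                laurent_monomial d *+ (d == a S)).
  by apply: eq_big => d; rewrite ?in_setT // dim_negami_state sumrMnr.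
rewrite exchange_big raddf_sum; apply: eq_bigr => S _ /=.
rewrite -laurent_monomial_state_deg ?max_card // -/(a S).
rewrite (bigD1_seq (a S)) ?undup_uniq //= eqxx big1 ?addr0 // => d /negPf->.
by rewrite mulr0n.
Qed.

End StateObject.

Theorem theorem3p2 (k : fieldType) :
  (forall G H : graph,
     graph_iso G H -> gr_iso (negami_state k G) (negami_state k H)) /\
  (exists f : graph -> {mpoly int[3]},
     unique is_negami f /\
     forall G : graph, Hilb (negami_state k G) = tofrac (f G)).
Proof.
split; first exact: negami_state_iso.
exists negami_poly; split; last exact: Hilb_negami_state.
split; first exact: negami_poly_is_negami.
by move=> g; apply: is_negami_unique; apply: negami_poly_is_negami.
Qed.
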